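(* Let $C$ be an $s\times m$ matrix with entries in $\mathbb{Q}_+$ and with non-zero columns, let $\mathcal{Q}(C)$ be its covering polyhedron, and let $\mathcal{F}=\{I_n\}_{n=0}^\infty$ be the filtration associated to $\mathcal{Q}(C)$. Let $\widehat{\alpha}(\mathcal{F})$ be the Waldschmidt constant of $\mathcal{F}$. Then the linear program in the variables $y=(y_1,\ldots,y_s)$ $$\text{minimize } y_1+\cdots+y_s\quad\text{subject to } yC\geq 1 \text{ and } y\geq 0$$ has an optimal value equal to $\widehat{\alpha}(\mathcal{F})$, which is attained at a rational vertex $\beta$ of $\mathcal{Q}(C)$.
   Context: $S=K[t_1,\ldots,t_s]$ is a polynomial ring over a field $K$; for $a=(a_1,\ldots,a_s)\in\mathbb{N}^s$, where $\mathbb{N}=\{0,1,\ldots\}$, $t^a=t_1^{a_1}\cdots t_s^{a_s}$. $\mathbb{Q}_+$ is the set of non-negative rational numbers. Vector inequalities are componentwise, vectors $x,y$ multiplying a matrix on the left are row vectors, and $1$ also denotes the vector $(1,\ldots,1)$. The covering polyhedron of $C$ is $\mathcal{Q}(C)=\{x\in\mathbb{R}^s \mid x\geq 0;\ xC\geq 1\}$. The filtration associated to $\mathcal{Q}(C)$ is the sequence of monomial ideals $I_0=S$ and, for $n\geq 1$, $I_n$ the ideal generated by all monomials $t^a$, $a\in\mathbb{N}^s$, with $a/n\in\mathcal{Q}(C)$. For $n\geq 1$, $\alpha_{\mathcal{F}}(n)$ is the least degree of a monomial in $I_n$, and the Waldschmidt constant of $\mathcal{F}$ is $\widehat{\alpha}(\mathcal{F})=\lim_{n\to\infty}\alpha_{\mathcal{F}}(n)/n$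 (this limit exists and equals $\inf_{n\geq 1}\alpha_{\mathcal{F}}(n)/n$). *)

(* Defs.v *)
From mathcomp Require Import all_boot all_order all_algebra.
From mathcomp Require Import all_classical all_reals all_analysis.
(* The notations of mpoly clash with those of mathcomp-analysis: below,
   [mpoly s K] is {mpoly K[s]}, [multinom s] is 'X_{1..s} (exponent vectors
   in N^s) and [mpolyX K a] is the monomial 'X_[a]. *)
From mathcomp Require Import -(notations) mpoly.

Set Implicit Arguments.
Unset Strict Implicit.
Unset Printing Implicit Defensive.

Import Order.TTheory GRing.Theory Num.Theory.
Import numFieldNormedType.Exports.
Local Open Scope classical_set_scope.
Local Open Scope ring_scope.

(* Not necessarily proper, unlike [idealr_closed]. *)
Definition is_ideal (A : comNzRingType) (I : set A) : Prop :=
  [/\ I 0,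
      forall p q, I p -> I q -> I (p + q)
    & forall p q, I q -> I (p * q)].

Definition ideal_gen (A : comNzRingType) (G : set A) : set A :=
  smallest (@is_ideal A) G.

Definition covering_polyhedron (R : realType) (s m : nat) (C : 'M[rat]_(s, m)) :
    set 'rV[R]_s :=
  [set x : 'rV[R]_s | (forall i, 0 <= x 0 i)
                  /\ (forall j, 1 <= (x *m map_mx ratr C) 0 j)].

Definition covering_filtration (R : realType) (K : fieldType) (s m : nat)
    (C : 'M[rat]_(s, m)) (n : nat) : set (mpoly s K) :=
  if n is 0%N then setT
  else ideal_gen [set mpolyX K a | a in
         [set a : multinom s |
            covering_polyhedron C (\row_i ((a i)%:R / n%:R) : 'rV[R]_s)]].

Section Waldschmidt.
Variables (K : fieldType) (s : nat).

Definition monomial_degrees (I : set (mpoly s K)) : set nat :=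
  [set mdeg a | a in [set a : multinom s | I (mpolyX K a)]].

(* The least element of [monomial_degrees (F n)]. The default 0 of [xget] plays
   no role for the filtration of a covering polyhedron: when C is nonnegative
   with nonzero columns, (k, ..., k)/n lies in it for all large k. *)
Definition alpha (F : nat -> set (mpoly s K)) (n : nat) : nat :=
  xget 0%N [set d | monomial_degrees (F n) d
                 /\ forall e, monomial_degrees (F n) e -> (d <= e)%N].

(* The term of index 0 is irrelevant to the limit. *)
Definition waldschmidt_seq (R : realType) (F : nat -> set (mpoly s K)) :
    nat -> R :=
  fun n => (alpha F n)%:R / n%:R.

Definition waldschmidt (R : realType) (F : nat -> set (mpoly s K)) : R :=
  lim (waldschmidt_seq R F @ \oo).

End Waldschmidt.

Section Polyhedra.
Variables (R : realType) (s : nat).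

(* Faces cut out by valid inequalities; c = 0 is allowed, so P is a face of
   itself (which matters when P is a single point). *)
Definition is_face (P F : set 'rV[R]_s) : Prop :=
  exists (c : 'rV[R]_s) (d : R),
    (forall x, P x -> d <= \sum_i c 0 i * x 0 i)
    /\ F = P `&` [set x | \sum_i c 0 i * x 0 i = d].

(* A vertex is a face of dimension 0. *)
Definition is_vertex (P : set 'rV[R]_s) (v : 'rV[R]_s) : Prop :=
  is_face P [set v].

Definition is_minimizer (P : set 'rV[R]_s) (f : 'rV[R]_s -> R) (x : 'rV[R]_s) :
    Prop :=
  P x /\ forall y, P y -> f x <= f y.

Definition has_optimal_value (P : set 'rV[R]_s) (f : 'rV[R]_s -> R) (v : R) :
    Prop :=
  exists2 x, is_minimizer P f x & f x = v.

Definition coord_sum (y : 'rV[R]_s) : R := \sum_i y 0 i.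

End Polyhedra.

(* Main.v *)
Require Import Defs.
From mathcomp Require Import all_boot all_order all_algebra.
From mathcomp Require Import all_classical all_reals all_analysis.
From mathcomp Require Import -(notations) mpoly.
From mathcomp Require Import lra.
Import Order.TTheory GRing.Theory Num.Theory.
Import numFieldNormedType.Exports.
Local Open Scope classical_set_scope.
Local Open Scope ring_scope.

(** The theorem combines a linear programming fact with a rounding argument.

    Linear programming. The covering polyhedron [Q] is cut out by finitely many
    rational inequalities, and lies in the positive orthant. From a point of
    [Q] at which the tight inequalities do not determine the point, one can
    move along a line that keeps them tight, in the sense that does not increase
    the sum of the coordinates; since that sense must make some coordinate
    decrease, a new inequality becomes tight before [Q] is left. Repeating this
    ends at a basic point, one determined by its tight inequalities
    ([basic_point_below]). There are finitely many basic points, at most one for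
    each set of inequalities, so one of them minimizes the objective over the
    whole of [Q] ([basic_minimizer]). A basic point is a vertex, exposed by the
    sum of its tight inequalities ([basic_point_vertex]), and it is rational
    because it is the only solution of a rational linear system
    ([basic_point_rational]).

    Rounding. As [C] is nonnegative, [Q] is stable under increasing
    coordinates. Hence the exponents [a] with [a / n] in [Q] are already the
    exponents of a monomial ideal, and [alpha n] is the least degree of such an
    [a] ([mpolyX_in_covering_filtration]). If [b] minimizes the sum of the
    coordinates over [Q], then [coord_sum b] is at most [alpha n / n], since
    [a / n] competes with [b]. Conversely, rounding the coordinates of [n b] up
    gives an admissible exponent whose degree exceeds [n * coord_sum b] by at
    most [s]. So [alpha n / n] differs from [coord_sum b] by at most [s / n]
    ([alpha_covering_bounds]), and its limit is [coord_sum b]. *)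

(** * Basic points of polyhedra *)

Definition polyhedron {F : realFieldType} {s N : nat} (A : 'M[F]_(s, N))
    (b : 'rV[F]_N) : set 'rV[F]_s :=
  [set x | forall k, b 0 k <= (x *m A) 0 k].

Definition tight {F : realFieldType} {s N : nat} (A : 'M[F]_(s, N))
    (b : 'rV[F]_N) (x : 'rV[F]_s) : {set 'I_N} :=
  finset (fun k => (x *m A) 0 k == b 0 k).

(** A basic feasible solution. The full rank of the tight columns is expressed
    by the triviality of their left kernel, which is the form in which it is
    obtained and used. *)
Definition basic_point {F : realFieldType} {s N : nat} (A : 'M[F]_(s, N))
    (b : 'rV[F]_N) (x : 'rV[F]_s) : Prop :=
  polyhedron A b x /\
  forall h : 'rV_s, {in tight A b x, forall k, (h *m A) 0 k = 0} -> h = 0.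

Lemma mulmxBl_entry {F : realFieldType} {s N : nat} (A : 'M[F]_(s, N))
    (x y : 'rV[F]_s) k :
  ((x - y) *m A) 0 k = (x *m A) 0 k - (y *m A) 0 k.
Proof. by rewrite mulmxBl mxE [in X in _ + X]mxE. Qed.

Section BasicPoints.
Variables (F : realFieldType) (s N : nat) (A : 'M[F]_(s, N)) (b : 'rV[F]_N).
Implicit Types x y h : 'rV[F]_s.
Local Notation P := (polyhedron A b).

(** The ratio test of the simplex method: moving along [h] leaves the tight
    constraints tight, and the first of the constraints decreasing along [h] to
    be exhausted becomes tight. *)
Lemma move_to_new_constraint x h :
    P x -> {in tight A b x, forall k, (h *m A) 0 k = 0} ->
    (exists k, (h *m A) 0 k < 0) ->
  exists2 t, 0 <= t & P (x + t *: h) /\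
    tight A b x \proper tight A b (x + t *: h).
Proof.
move=> Px hT [k0 hk0].
pose slack k := (x *m A) 0 k - b 0 k.
pose ratio k := slack k / - (h *m A) 0 k.
case: (arg_minP ratio (i0 := k0) (P := fun k => (h *m A) 0 k < 0) hk0)
  => k hk kmin.
have rE k' : ((x + ratio k *: h) *m A) 0 k' =
             (x *m A) 0 k' + ratio k * (h *m A) 0 k'.
  by rewrite mulmxDl -scalemxAl !mxE.
have r_ge0 : 0 <= ratio k.
  by rewrite divr_ge0 ?subr_ge0 ?oppr_ge0 ?(ltW hk) //; exact: Px.
exists (ratio k) => //; split.
  move=> k' /=; rewrite rE.
  have [h'0|h'0] := ltP ((h *m A) 0 k') 0.
    have := kmin k' h'0.
    rewrite {2}/ratio ler_pdivlMr ?oppr_gt0 // /slack => ?; lra.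
  have := Px k'; have := mulr_ge0 r_ge0 h'0; lra.
apply/properP; split.
  apply/fintype.subsetP => k' k'T; rewrite inE rE hT // mulr0 addr0.
  by move: k'T; rewrite inE.
exists k.
  rewrite inE rE /ratio /slack; apply/eqP.
  have : (h *m A) 0 k != 0 by rewrite lt_eqF.
  by move=> h0; rewrite invrN mulrN mulNr mulfVK // opprB addrCA subrr addr0.
by apply: contraTN hk => /hT ->; rewrite ltxx.
Qed.

Lemma tight_basic_inj x y :
  basic_point A b x -> tight A b x = tight A b y -> x = y.
Proof.
move=> [_ xB] xy; apply/eqP; rewrite -subr_eq0; apply/eqP/xB => k kT.
have := kT; rewrite xy; move: kT; rewrite !inE => /eqP xk /eqP yk.
by rewrite mulmxBl_entry xk yk subrr.
Qed.

Section Minimization.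
Variable c : 'cV[F]_s.
(* The objective is positive on nonzero recession directions, so that no
   direction that does not increase it can be followed forever. *)
Hypothesis c_pos : forall h, (forall k, 0 <= (h *m A) 0 k) ->
  (h *m c) 0 0 <= 0 -> h = 0.

(** Induction on the number of constraints that are not tight: at a point that
    is not basic, some [h] is orthogonal to all the tight columns, and one of
    [h] and [- h] does not increase the objective. *)
Lemma basic_point_below x : P x ->
  exists2 y, basic_point A b y & (y *m c) 0 0 <= (x *m c) 0 0.
Proof.
have [n] := ubnP (N - #|tight A b x|); elim: n x => // n IHn x xn Px.
have [xB|] := pselect (basic_point A b x); first by exists x.
move=> /not_andP[//|] /existsNP[h /not_implyP[hT /eqP h0]].
wlog ch : h hT h0 / (h *m c) 0 0 <= 0.
  move=> WL; have [|/ltW ch] := leP ((h *m c) 0 0) 0; first exact: WL.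
  apply: (WL (- h)); rewrite ?oppr_eq0 //.
    by move=> k /hT hk; rewrite mulNmx mxE hk oppr0.
  by rewrite mulNmx mxE oppr_le0.
have [k hk] : exists k, (h *m A) 0 k < 0.
  apply: contrapT => /forallNP hA; case/eqP: h0; apply: c_pos => // k.
  by rewrite leNgt; apply/negP/hA.
have [t t0 [Py xy]] := move_to_new_constraint x h Px hT (ex_intro _ k hk).
have [|//|z zB zy] := IHn (x + t *: h).
  rewrite ltnS in xn; apply: leq_trans xn.
  have := proper_card xy; have := max_card (mem (tight A b (x + t *: h))).
  rewrite card_ord => le1 lt1; apply: ltn_sub2l => //; exact: leq_trans lt1 le1.
exists z => //; apply: le_trans zy _.
by rewrite mulmxDl -scalemxAl [leLHS]mxE gerDl mxE mulr_ge0_le0.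
Qed.

(** The infimum over the polyhedron is a minimum over the basic points, which
    are finitely many by [tight_basic_inj]. *)
Lemma basic_minimizer : (exists x, P x) ->
  exists2 y, basic_point A b y & forall x, P x -> (y *m c) 0 0 <= (x *m c) 0 0.
Proof.
move=> [x0 /basic_point_below[y0 y0B _]].
pose basic_of (J : {set 'I_N}) : 'rV_s :=
  xget 0 [set y | basic_point A b y /\ tight A b y = J].
(* [basic_of J] is 0 when [J] is the tight set of no basic point; [isB] leaves
   out those [J] for which this value is not itself basic. *)
pose isB J := `[< basic_point A b (basic_of J) >].
have basic_ofK y : basic_point A b y -> basic_of (tight A b y) = y.
  move=> yB; rewrite /basic_of; case: xgetP => [z _ [zB zy]|/(_ y)[]//].
  exact: tight_basic_inj.
have i0B : isB (tight A b y0) by apply/asboolP; rewrite basic_ofK.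
case: (arg_minP (fun J => (basic_of J *m c) 0 0) i0B) => J /asboolP JB Jmin.
exists (basic_of J) => // x /basic_point_below[y yB]; apply: le_trans.
have := Jmin (tight A b y); rewrite basic_ofK //; apply.
by apply/asboolP; rewrite basic_ofK.
Qed.

End Minimization.
End BasicPoints.

(** The sum of the tight inequalities is a valid inequality. Equality in it
    forces equality in each of them, and only [x] achieves that. *)
Lemma basic_point_vertex (R : realType) (s N : nat) (A : 'M[R]_(s, N))
    (b : 'rV[R]_N) (x : 'rV[R]_s) :
  basic_point A b x -> is_vertex (polyhedron A b) x.
Proof.
move=> [Px xB].
pose c : 'rV[R]_s := \row_i \sum_(k in tight A b x) A i k.
have cE (y : 'rV[R]_s) :
    \sum_i c 0 i * y 0 i = \sum_(k in tight A b x) (y *m A) 0 k.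
  under eq_bigr do rewrite mxE mulr_suml.
  rewrite exchange_big; apply: eq_bigr => k _; rewrite mxE.
  by apply: eq_bigr => i _; rewrite mulrC.
exists c, (\sum_(k in tight A b x) b 0 k); split=> [y Py|].
  by rewrite cE; apply: ler_sum => k _; exact: Py.
apply/seteqP; split=> [_ -> /=|y [Py /=]].
  by split=> //; rewrite cE; apply: eq_bigr => k; rewrite inE => /eqP.
rewrite cE => /eqP; rewrite -subr_eq0 -sumrB psumr_eq0 => [|k _]; last first.
  by rewrite subr_ge0; exact: Py.
move=> /allP yT; apply/eqP; rewrite -subr_eq0; apply/eqP/xB => k kT.
have /implyP/(_ kT) := yT k (mem_index_enum k).
rewrite subr_eq0 => /eqP yk.
by move: kT; rewrite inE => /eqP xk; rewrite mulmxBl_entry yk xk subrr.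
Qed.

(** The tight constraints form a rational linear system that has a solution
    over [F]; solvability of linear systems does not depend on the field, so
    there is a rational solution, and it must be [x] by uniqueness. *)
Lemma basic_point_rational (F : realFieldType) (s N : nat) (A : 'M[rat]_(s, N))
    (b : 'rV[rat]_N) (x : 'rV[F]_s) :
  basic_point (map_mx ratr A) (map_mx ratr b) x ->
  exists y : 'rV[rat]_s, x = map_mx ratr y.
Proof.
move=> [_ xB]; set T := tight _ _ _ in xB.
have diagE (E : fieldType) (B : 'rV[E]_N) k :
    (B *m diag_mx (\row_k (k \in T)%:R)) 0 k = B 0 k * (k \in T)%:R.
  by rewrite mul_mx_diag !mxE.
(* Right multiplication by [D E] zeroes out the columns that are not tight. *)
pose D (E : fieldType) : 'M[E]_N := diag_mx (\row_k (k \in T)%:R).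
have DE : D F = map_mx ratr (D rat).
  by rewrite map_diag_mx; congr diag_mx; apply/rowP => k;
    rewrite !mxE rmorph_nat.
have : (b *m D rat <= A *m D rat)%MS.
  rewrite -(map_submx (@ratr F)) !map_mxM -DE; apply/submxP; exists x.
  apply/rowP => k; rewrite mulmxA !diagE.
  have [|_] := boolP (k \in T); last by rewrite !mulr0.
  by rewrite inE => /eqP->.
move=> /submxP[y yE]; exists y; apply/eqP; rewrite -subr_eq0.
apply/eqP/xB => k kT.
move/rowP/(_ k): yE; rewrite mulmxA !diagE kT !mulr1 => yk.
move: kT; rewrite inE => /eqP xk.
by rewrite mulmxBl_entry -map_mxM xk !mxE yk mxE subrr.
Qed.

(** * The covering polyhedron *)

Section CoveringPolyhedron.
Variables (R : realType) (s m : nat) (C : 'M[rat]_(s, m)).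
Hypothesis C_ge0 : forall i j, 0 <= C i j.
Local Notation Q := (covering_polyhedron C : set 'rV[R]_s).

Lemma covering_polyhedronE :
  Q = polyhedron (map_mx ratr (row_mx 1%:M C))
                 (map_mx ratr (row_mx 0 (const_mx 1))).
Proof.
rewrite !map_row_mx map_mx1 map_mx0 map_const_mx [ratr 1]rmorph1.
apply/seteqP; split=> x;
  rewrite /polyhedron /covering_polyhedron /= mul_mx_row mulmx1.
  move=> [x0 x1] k; case: (split_ordP k) => [i ->|j ->].
    by rewrite !row_mxEl mxE.
  by rewrite !row_mxEr mxE.
move=> xP; split=> [i|j].
  by have := xP (lshift m i); rewrite !row_mxEl mxE.
by have := xP (rshift s j); rewrite !row_mxEr [leLHS]mxE.
Qed.

Lemma covering_polyhedron_up (x y : 'rV[R]_s) :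
  Q x -> (forall i, x 0 i <= y 0 i) -> Q y.
Proof.
move=> [x0 x1] xy; split=> [i|j]; first exact: le_trans (x0 i) (xy i).
apply: le_trans (x1 j) _; rewrite !mxE; apply: ler_sum => i _.
by rewrite ler_wpM2r // mxE ler0q.
Qed.

(** A nonzero nonnegative column has a positive sum, so a constant vector with
    large enough entries satisfies all the constraints. *)
Lemma covering_polyhedron_nonempty :
  (forall j, col j C != 0) -> exists x, Q x.
Proof.
move=> C_col; pose S j : R := \sum_i ratr (C i j).
have term_ge0 i j : 0 <= ratr (C i j) :> R by rewrite ler0q.
have S_gt0 j : 0 < S j.
  rewrite lt0r sumr_ge0 // andbT; apply: contra (C_col j) => /eqP S0.
  apply/eqP/colP => i; rewrite !mxE.
  have /psumr_eq0P/(_ S0 i isT)/eqP :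
    forall i, true -> 0 <= ratr (C i j) :> R by [].
  by rewrite fmorph_eq0 => /eqP.
have V_ge0 j : 0 <= (S j)^-1 by rewrite invr_ge0 ltW.
exists (const_mx (\sum_j (S j)^-1)); split=> [i|j].
  by rewrite mxE sumr_ge0.
rewrite mxE; under eq_bigr do rewrite !mxE.
rewrite -mulr_sumr -/(S j) -ler_pdivrMr // div1r (bigD1 j) //= lerDl.
exact: sumr_ge0.
Qed.

Lemma covering_minimizer : (exists x, Q x) ->
  exists beta : 'rV[rat]_s, let b : 'rV[R]_s := map_mx ratr beta in
    is_vertex Q b /\ is_minimizer Q (@coord_sum R s) b.
Proof.
have sumE (x : 'rV[R]_s) : (x *m (const_mx 1 : 'cV_s)) 0 0 = coord_sum x.
  by rewrite mxE; apply: eq_bigr => i _; rewrite mxE mulr1.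
rewrite covering_polyhedronE => Q0.
(* The recession cone lies in the positive orthant, where only the origin has
   a coordinate sum at most 0. *)
have [|b bB bmin] := basic_minimizer _ _ _ _ _ (const_mx 1) _ Q0.
- move=> h hA; rewrite sumE => h1.
  have h0 i : true -> 0 <= h 0 i.
    have := hA (lshift m i).
    by rewrite map_row_mx map_mx1 mul_mx_row mulmx1 row_mxEl.
  have /(psumr_eq0P h0) hE : coord_sum h = 0.
    by apply/eqP; rewrite eq_le h1 sumr_ge0.
  by apply/rowP => i; rewrite mxE hE.
have [beta bE] := basic_point_rational _ _ _ _ _ _ bB.
exists beta => /=; rewrite -bE; split; first exact: basic_point_vertex.
by split=> [|y /bmin]; [case: bB|rewrite !sumE].
Qed.

End CoveringPolyhedron.

(** * The filtration and its initial degrees *)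

(** The polynomials all of whose monomials have exponents in [U] form an ideal,
    because [U] is closed under addition of exponents. *)
Lemma mpolyX_in_monomial_ideal (K : fieldType) (s : nat) (U : set (multinom s))
    (a : multinom s) :
    (forall b c, U c -> U (mnm_add b c)) ->
  ideal_gen [set mpolyX K c | c in U] (mpolyX K a) <-> U a.
Proof.
move=> U_up; split; last by move=> Ua J [_]; apply; exists a.
pose I : set (mpoly s K) := [set p | forall c, c \in msupp p -> U c].
suff sub : ideal_gen [set mpolyX K c | c in U] `<=` I.
  by move=> /sub; apply; rewrite msuppX mem_seq1.
apply: smallest_sub; last first.
  by move=> _ [c Uc <-] d; rewrite msuppX mem_seq1 => /eqP->.
split=> [c|p q Ip Iq c|p q Iq c]; first by rewrite msupp0.
  by move=> /msuppD_le; rewrite mem_cat => /orP[/Ip|/Iq].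
by move=> /msuppM_le/allpairsP[[b d] [_ /Iq Ud ->]]; exact: U_up.
Qed.

Lemma mpolyX_in_covering_filtration (R : realType) (K : fieldType) (s m : nat)
    (C : 'M[rat]_(s, m)) (n : nat) (a : multinom s) :
    (forall i j, 0 <= C i j) -> (0 < n)%N ->
  covering_filtration R (K := K) C n (mpolyX K a) <->
  covering_polyhedron C (\row_i ((a i)%:R / n%:R) : 'rV[R]_s).
Proof.
case: n => // n C_ge0 _; apply: mpolyX_in_monomial_ideal => b c /= Qc.
apply: covering_polyhedron_up Qc _ => // i.
by rewrite !mxE ler_wpM2r ?invr_ge0 // ler_nat mnmDE leq_addl.
Qed.

Lemma alpha_least (K : fieldType) (s : nat) (F : nat -> set (mpoly s K))
    (n : nat) :
    (exists d, monomial_degrees (F n) d) ->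
  monomial_degrees (F n) (alpha F n) /\
  forall e, monomial_degrees (F n) e -> (alpha F n <= e)%N.
Proof.
move=> [d0 d0P]; apply: (@xgetPex _ 0%N [set d | monomial_degrees (F n) d /\
  forall e, monomial_degrees (F n) e -> (d <= e)%N]).
have ex : exists d, `[< monomial_degrees (F n) d >] by exists d0; apply/asboolP.
case: (ex_minnP ex) => d /asboolP dP dmin; exists d; split=> // e eP.
by apply: dmin; apply/asboolP.
Qed.

(** The lower bound holds because [a / n] lies in the polyhedron for an exponent
    [a] of least degree; the upper bound because rounding [n b] up costs at most
    1 in each of the [s] coordinates. *)
Lemma alpha_covering_bounds (R : realType) (K : fieldType) (s m : nat)
    (C : 'M[rat]_(s, m)) (b : 'rV[R]_s) (n : nat) :
    (forall i j, 0 <= C i j) -> (0 < n)%N ->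
    is_minimizer (covering_polyhedron C) (@coord_sum R s) b ->
  coord_sum b <= waldschmidt_seq R (covering_filtration R (K := K) C) n
              <= coord_sum b + s%:R / n%:R.
Proof.
move=> C_ge0 n_gt0 [Qb bmin]; set F := covering_filtration _ _.
have nR_gt0 : 0 < n%:R :> R by rewrite ltr0n.
(* The floor plus one serves as the rounding up, at excess at most 1. *)
pose r : multinom s := Multinom [tuple (Num.truncn (n%:R * b 0 i)).+1 | i < s].
have degF : monomial_degrees (F n) (mdeg r).
  exists r => //=; apply/mpolyX_in_covering_filtration => //.
  apply: covering_polyhedron_up Qb _ => // i.
  by rewrite mxE mnmE ler_pdivlMr // mulrC ltW // truncnS_gt.
have [[a Fa degE] amin] := alpha_least K s F n (ex_intro _ _ degF).
rewrite /waldschmidt_seq; apply/andP; split.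
  have /bmin : covering_polyhedron C (\row_i ((a i)%:R / n%:R) : 'rV[R]_s).
    exact/(mpolyX_in_covering_filtration R K).
  rewrite -degE mdegE natr_sum mulr_suml /coord_sum.
  by under [leRHS]eq_bigr do rewrite mxE.
rewrite ler_pdivrMr // mulrDl divfK ?gt_eqF //.
apply: (@le_trans _ _ (mdeg r)%:R); first by rewrite ler_nat amin.
rewrite mdegE natr_sum /coord_sum mulr_suml -[leRHS]addrC.
have -> : s%:R = \sum_(i < s) 1 :> R by rewrite sumr_const card_ord.
rewrite -big_split ler_sum // => i _; rewrite mnmE -natr1 addrC lerD2l.
have bi0 : 0 <= n%:R * b 0 i by rewrite mulr_ge0 ?ler0n //; case: Qb.
by have /andP[] := truncn_itv bi0; rewrite [b 0 i * _]mulrC.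
Qed.

Theorem theorem3p4 (R : realType) (K : fieldType) (s m : nat)
    (C : 'M[rat]_(s, m))
    (C_ge0 : forall i j, 0 <= C i j)
    (C_col : forall j, col j C != 0) :
  let Q : set 'rV[R]_s := covering_polyhedron C in
  let F : nat -> set (mpoly s K) := covering_filtration R (K := K) C in
  [/\ cvg (waldschmidt_seq R F @ \oo),
      has_optimal_value Q (@coord_sum R s) (waldschmidt R F)
    & exists beta : 'rV[rat]_s,
        let b : 'rV[R]_s := map_mx ratr beta in
        [/\ is_vertex Q b,
            is_minimizer Q (@coord_sum R s) b
          & coord_sum b = waldschmidt R F]].
Proof.
move=> Q F.
have [beta [bvert bmin]] :=
  covering_minimizer R s m C (covering_polyhedron_nonempty R s m C C_ge0 C_col).
set b : 'rV[R]_s := map_mx ratr beta in bvert bmin.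
have W : waldschmidt_seq R F @ \oo --> coord_sum b.
  (* The shift avoids the index 0, where [s / n] bounds nothing. *)
  rewrite -cvg_shiftS.
  apply: (@squeeze_cvgr _ _ _ _ (fun=> coord_sum b)
    (fun n => coord_sum b + s%:R * harmonic n)).
  - by apply: nearW => n; exact: alpha_covering_bounds.
  - exact: cvg_cst.
  - rewrite -[X in _ --> X]addr0; apply: cvgD; first exact: cvg_cst.
    by rewrite -(mulr0 s%:R); apply: cvgM; [exact: cvg_cst|exact: cvg_harmonic].
have WE : waldschmidt R F = coord_sum b by exact: cvg_lim.
split; [by apply/cvg_ex; exists (coord_sum b) | by exists b|].
by exists beta; split.
Qed.
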